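(* $1\oplus\nsubseteq 1\mathrm{P}$.
   Context: A one-way nondeterministic finite automaton (1nfa) is $M=(Q,\Sigma,\{\rhd,\lhd\},\delta,q_0,Q_{acc},Q_{rej})$: finite state set $Q$, input alphabet $\Sigma$, endmarkers $\rhd,\lhd\notin\Sigma$, disjoint sets $Q_{acc},Q_{rej}\subseteq Q$ of accepting and rejecting states ($Q_{halt}=Q_{acc}\cup Q_{rej}$), and transition function $\delta:(Q-Q_{halt})\times(\Sigma\cup\{\rhd,\lhd\})\to\mathcal P(Q)$. On input $x$ it reads $\rhd x\lhd$ left to right, moving its head one cell right at every step (no $\lambda$-moves), halting when it enters a halting state. A computation path is accepting (resp. rejecting) if it enters a state of $Q_{acc}$ (resp. $Q_{rej}$); a path reading off $\lhd$ without entering a halting state is neither. $\#M(x)$, $\#\overline{M}(x)$ denote the numbers of accepting and rejecting computation paths on $x$. The state complexity of $M$ is $|Q|$; a family $\{M_n\}_{n\in\mathbb N}$ has polynomial size if the state complexity of $M_n$ is at most $p(n)$ for a fixed polynomial $p$. A family of promise problems over a fixed alphabet $\Sigma$ is $\mathcal L=\{(L_n^{(+)},L_n^{(-)})\}_{n\in\mathbb N}$ with $L_n^{(+)},L_n^{(-)}\subseteq\Sigma^*$ disjoint. A family of partial functions is $\{(f_n,D_n)\}_n$ with $f_n$ defined on $D_n\subseteq\Sigma^*$. $1\#$ is the class of such families for which some polynomial-size family of 1nfa's $\{M_n\}$ satisfies $f_n(x)=\#M_n(x)$ for all $n$ and $x\in D_n$; $1\mathrm{Gap}$ is defined likewise with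 $f_n(x)=\#M_n(x)-\#\overline{M}_n(x)$. $\mathcal L\in 1\oplus$ iff there is $\{(f_n,D_n)\}\in 1\#$ with $L_n^{(+)}\cup L_n^{(-)}\subseteq D_n$, $f_n(x)$ odd for $x\in L_n^{(+)}$ and $f_n(x)$ even for $x\in L_n^{(-)}$, for all $n$. $\mathcal L\in 1\mathrm P$ iff there is $\{(f_n,D_n)\}\in1\mathrm{Gap}$ with $L_n^{(+)}\cup L_n^{(-)}\subseteq D_n$, $f_n(x)>0$ for $x\in L_n^{(+)}$ and $f_n(x)\le0$ for $x\in L_n^{(-)}$, for all $n$. *)

(* Defs.v *)
From HB Require Import structures.
From mathcomp Require Import all_boot all_order all_algebra.

Set Implicit Arguments.
Unset Strict Implicit.
Unset Printing Implicit Defensive.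

Import Order.TTheory GRing.Theory Num.Theory.

Local Open Scope ring_scope.

Inductive tape_symbol (Sigma : Type) : Type :=
  | LeftEnd
  | RightEnd
  | Letter of Sigma.

Arguments LeftEnd {Sigma}.
Arguments RightEnd {Sigma}.

Definition tape (Sigma : Type) (x : seq Sigma) : seq (tape_symbol Sigma) :=
  LeftEnd :: rcons (map (@Letter Sigma) x) RightEnd.

(* [nfa_delta] is total for convenience; its values at halting states are never
   consulted (see [is_run]). *)
Record nfa (Sigma : finType) : Type := Nfa {
  nfa_state : finType;
  nfa_delta : nfa_state -> tape_symbol Sigma -> {set nfa_state};
  nfa_init : nfa_state;
  nfa_acc : {set nfa_state};
  nfa_rej : {set nfa_state};
  nfa_acc_rej_disjoint : [disjoint nfa_acc & nfa_rej]
}.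

Definition nfa_halt (Sigma : finType) (M : nfa Sigma) : {set nfa_state M} :=
  nfa_acc M :|: nfa_rej M.

(* [p] lists the states entered after [q] while reading a prefix of [w], one
   symbol per step; no step leaves a halting state. *)
Fixpoint is_run (Sigma : finType) (M : nfa Sigma) (q : nfa_state M)
    (w : seq (tape_symbol Sigma)) (p : seq (nfa_state M)) {struct p} : bool :=
  match p, w with
  | [::], _ => true
  | q' :: p', a :: w' =>
      [&& q \notin nfa_halt M, q' \in nfa_delta q a & is_run q' w' p']
  | _ :: _, [::] => false
  end.

(* Since halting states have no successor, a run whose last state is in
   [F \subset nfa_halt M] is a complete computation path. A run has at most one
   step per tape cell, so sequences of length at most [size (tape x)] suffice. *)
Definition paths_into (Sigma : finType) (M : nfa Sigma)
    (F : {set nfa_state M}) (x : seq Sigma) : nat :=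
  #|[set p : (size (tape x)).-bseq (nfa_state M) |
      is_run (nfa_init M) (tape x) p && (last (nfa_init M) p \in F)]|.

Definition num_acc (Sigma : finType) (M : nfa Sigma) (x : seq Sigma) : nat :=
  paths_into (nfa_acc M) x.

Definition num_rej (Sigma : finType) (M : nfa Sigma) (x : seq Sigma) : nat :=
  paths_into (nfa_rej M) x.

Definition state_complexity (Sigma : finType) (M : nfa Sigma) : nat :=
  #|nfa_state M|.

Definition polynomial_size (Sigma : finType) (M : nat -> nfa Sigma) : Prop :=
  exists p : {poly nat}, forall n : nat, (state_complexity (M n) <= p.[n])%N.

(* The alphabet is part of the family: it is the same for all indices [n], but
   different families may use different alphabets. *)
Record promise_family : Type := PromiseFamily {
  alphabet : finType;
  pos : nat -> seq alphabet -> Prop;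
  neg : nat -> seq alphabet -> Prop;
  pos_neg_disjoint : forall (n : nat) (x : seq alphabet),
    ~ (pos n x /\ neg n x)
}.

(* The values of [pf_val n] outside [pf_dom n] are meaningless. *)
Record partial_family (Sigma : finType) (V : Type) : Type := PartialFamily {
  pf_dom : nat -> seq Sigma -> Prop;
  pf_val : nat -> seq Sigma -> V
}.

Definition one_sharp (Sigma : finType) (f : partial_family Sigma nat) : Prop :=
  exists M : nat -> nfa Sigma,
    polynomial_size M /\
    forall (n : nat) (x : seq Sigma), pf_dom f n x ->
      pf_val f n x = num_acc (M n) x.

Definition one_gap (Sigma : finType) (f : partial_family Sigma int) : Prop :=
  exists M : nat -> nfa Sigma,
    polynomial_size M /\
    forall (n : nat) (x : seq Sigma), pf_dom f n x ->
      pf_val f n x = (num_acc (M n) x)%:Z - (num_rej (M n) x)%:Z.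

Definition promise_in_dom (L : promise_family) (V : Type)
    (f : partial_family (alphabet L) V) : Prop :=
  forall (n : nat) (x : seq (alphabet L)),
    pos n x \/ neg n x -> pf_dom f n x.

Definition one_parity (L : promise_family) : Prop :=
  exists f : partial_family (alphabet L) nat,
    [/\ one_sharp f,
        promise_in_dom f,
        forall (n : nat) (x : seq (alphabet L)), pos n x -> odd (pf_val f n x)
      & forall (n : nat) (x : seq (alphabet L)),
          neg n x -> ~~ odd (pf_val f n x)].

Definition one_P (L : promise_family) : Prop :=
  exists f : partial_family (alphabet L) int,
    [/\ one_gap f,
        promise_in_dom f,
        forall (n : nat) (x : seq (alphabet L)), pos n x -> 0 < pf_val f n x
      & forall (n : nat) (x : seq (alphabet L)), neg n x -> pf_val f n x <= 0].

(* Main.v *)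
(* Everything happens over a one-letter alphabet. Let alpha be a primitive
   element of GF(2^(2n+2)), l a nonzero linear form to GF(2) and
   N = 4^(n+1) - 1. The bit s(m) = l(alpha^m) is the parity of the number of
   accepting paths on the input of length m of an automaton that tracks the
   coordinates of alpha^m, so it is easy for parity automata.

   The gap of an automaton with d states is g(m) = u A^m v. If g > 0 exactly
   when s = 1, then sigma(m) g(m) >= 0 for sigma = (-1)^(1-s). For a suitable y
   the weighted sequence y^m |g(m)| has a long window, cut into blocks of length
   N, whose two boundary blocks carry at most a third of its weight W. Put
   h(m) = \sum_j y^(m+jN) g(m+jN), with j ranging over the blocks of the window.
   The Hankel matrix H = (h(i+j)) of order N has rank at most d, and the absolute
   values in each of its rows add up to between 2W/3 and 4W/3; it has the signs
   of T = (sigma(i+j)), for which T^2 = (N+1) I - J with J the all-ones matrix.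
   Hence N * 2W/3 <= tr(HT) <= d |H| |T| <= d * 4W/3 * 2^(n+1), which forces d to
   be exponential in n. The balanced window replaces the isotropic position of
   Forster's sign-rank bound. *)

Require Import Defs.
From mathcomp Require Import all_boot all_order all_algebra all_solvable all_field.
From mathcomp Require Import ring lra zify.

Set Implicit Arguments.
Unset Strict Implicit.
Unset Printing Implicit Defensive.

Import Order.TTheory GRing.Theory Num.Theory.

Local Open Scope ring_scope.

(** * Counting computation paths *)

Section Counting.

Variables (Sigma : finType) (M : nfa Sigma).
Implicit Types (q : nfa_state M) (w : seq (tape_symbol Sigma))
  (F : {set nfa_state M}).

(** An explicit list of runs, which gives path counts a recursion along the tape that the
    cardinality in [paths_into] does not offer. *)
Fixpoint runs w q : seq (seq (nfa_state M)) :=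
  [::] :: (if w is a :: w' then
             if q \in nfa_halt M then [::]
             else [seq q' :: p | q' <- enum (nfa_delta q a), p <- runs w' q']
           else [::]).

Lemma mem_runs w q p : (p \in runs w q) = is_run q w p.
Proof.
elim: w q p => [|a w IHw] q [|q' p] //=; rewrite inE /=.
case: ifP => _ //=; apply/allpairsPdep/andP => [[r [s [rP sP [-> ->]]]]|[qq' pP]].
  by rewrite -IHw sP -(mem_enum (mem (nfa_delta q a))) rP.
by exists q', p; rewrite mem_enum IHw.
Qed.

Lemma uniq_runs w q : uniq (runs w q).
Proof.
elim: w q => [|a w IHw] q //=; apply/andP; split.
  by case: ifP => // _; apply/negP => /allpairsPdep [r [s [_ _]]].
case: ifP => // _; apply: allpairs_uniq_dep; first exact: enum_uniq.
  by move=> r _; apply: IHw.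
by move=> [r s] [r' s'] _ _ /= [-> ->].
Qed.

Definition num_runs F w q := count (fun p => last q p \in F) (runs w q).

Lemma paths_into_num_runs F x :
  paths_into F x = num_runs F (tape x) (nfa_init M).
Proof.
rewrite /paths_into /num_runs -size_filter cardE -(size_map val).
apply/perm_size/uniq_perm.
- by rewrite map_inj_uniq ?enum_uniq //; apply: val_inj.
- exact/filter_uniq/uniq_runs.
move=> p; rewrite mem_filter mem_runs andbC.
have szP w q r : is_run q w r -> (size r <= size w)%N.
  elim: w q r => [|a w IHw] q [|q' r] //= /and3P [_ _ /IHw].
  by rewrite ltnS.
apply/mapP/idP => [[r]|pP]; first by rewrite mem_enum inE => rP ->.
have [pr _] := andP pP.
by exists (Bseq (szP _ _ _ pr)); rewrite // mem_enum inE.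
Qed.

Lemma num_runs_nil F q : num_runs F [::] q = (q \in F).
Proof. by rewrite /num_runs /= addn0. Qed.

Lemma num_runs_halt F w q : q \in nfa_halt M -> num_runs F w q = (q \in F).
Proof. by move=> qh; case: w => [|a w]; rewrite /num_runs /= ?qh /= addn0. Qed.

Lemma num_runs_cons F a w q : q \notin nfa_halt M -> q \notin F ->
  num_runs F (a :: w) q = (\sum_(q' in nfa_delta q a) num_runs F w q')%N.
Proof.
move=> /negPf qh /negPf qF; rewrite /num_runs /= qh qF add0n.
rewrite count_flatten sumnE !big_map big_enum /=.
by apply: eq_bigr => q' _; rewrite count_map.
Qed.

End Counting.

(** * Gaps over a one-letter alphabet as matrix coefficients *)

Section GapMatrix.

Variable (M : nfa unit).
Local Notation d := #|nfa_state M|.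
Implicit Types (q : nfa_state M).

Definition run_gap w q : rat :=
  (num_runs (nfa_acc M) w q)%:R - (num_runs (nfa_rej M) w q)%:R.

(* Halting states become absorbing, so that one matrix per symbol describes
   the computation without keeping track of halted paths separately. *)
Definition step_mx (a : tape_symbol unit) : 'M[rat]_d :=
  \matrix_(i, j) (if enum_val i \in nfa_halt M then i == j
                  else enum_val j \in nfa_delta (enum_val i) a)%:R.

Definition gap_col w : 'cV[rat]_d := \col_i run_gap w (enum_val i).

Lemma gap_col_cons a w : gap_col (a :: w) = step_mx a *m gap_col w.
Proof.
apply/matrixP => i z; rewrite !mxE.
under eq_bigr do rewrite !mxE.
set q := enum_val i.
have [qh|qh] := boolP (q \in nfa_halt M).
  rewrite (bigD1 i) //= eqxx mul1r big1 ?addr0; last first.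
    by move=> j /negPf ji; rewrite eq_sym ji mul0r.
  by rewrite /run_gap !num_runs_halt.
have [qa qr] : q \notin nfa_acc M /\ q \notin nfa_rej M.
  by apply/andP; rewrite -negb_or -in_setU.
rewrite /run_gap !num_runs_cons // !natr_sum -sumrB.
rewrite big_mkcond (reindex (fun j : 'I_d => enum_val j)) /=; last first.
  by apply: onW_bij; apply: enum_val_bij.
by apply: eq_bigr => j _; case: (_ \in nfa_delta _ _); rewrite ?mul1r ?mul0r.
Qed.

(** Here [u] is the initial state's row for the left endmarker, [A] the step on the letter, and [v]
    the gaps from each state on the right endmarker alone. *)
Lemma gap_matrix_power : exists (u : 'rV[rat]_d) (A : 'M_d) (v : 'cV_d),
  forall m, (num_acc M (nseq m tt))%:R - (num_rej M (nseq m tt))%:R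
            = (u *m A ^+ m *m v) 0 0.
Proof.
exists (row (enum_rank (nfa_init M)) (step_mx LeftEnd)).
exists (step_mx (Letter tt)), (gap_col [:: RightEnd]) => m.
rewrite /num_acc /num_rej !paths_into_num_runs -/(run_gap _ _).
set w := rcons (map (@Letter unit) (nseq m tt)) RightEnd.
transitivity (gap_col (LeftEnd :: w) (enum_rank (nfa_init M)) 0).
  by rewrite mxE enum_rankK.
rewrite (gap_col_cons _ w) -mulmxA -row_mul [RHS]mxE.
suff -> : gap_col w = step_mx (Letter tt) ^+ m *m gap_col [:: RightEnd] by [].
rewrite /w {w}; elim: m => [|m IHm].
  by rewrite expr0 mul1mx.
by rewrite exprS -mulmxE -mulmxA -IHm -gap_col_cons.
Qed.

End GapMatrix.

(** * Maximal-length sequences and parity automata *)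

Lemma odd_natF2 k : odd k = ((k%:R : 'F_2) != 0).
Proof. by rewrite -(dvdn_pcharf (pchar_Fp (isT : prime 2))) dvdn2 negbK. Qed.

Lemma F2_cases (c : 'F_2) : c = (c != 0)%:R.
Proof. by apply/eqP; move: c; do 3?[case=> //]; case. Qed.

Section ParityMachine.

Variable (F : fieldExtType 'F_2) (a : F).
Local Notation n := (\dim {:F}).
Local Notation b := (vbasis {:F}).

Variable (l : {scalar F}).

(** [None] is the start, [Some None] accepts, and [Some (Some i)] stands for the i-th basis vector.
    Over GF(2) a vector is a set of basis vectors, so branching to the support of [a * b_i]
    multiplies by [a] at the level of path counts modulo 2. *)
Definition parity_delta (q : option (option 'I_n)) (s : tape_symbol unit) :
    {set option (option 'I_n)} :=
  match q, s with
  | None, LeftEnd => [set Some (Some j) | j : 'I_n & coord b j 1 != 0]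
  | Some (Some i), Letter _ =>
      [set Some (Some j) | j : 'I_n & coord b j (a * b`_i) != 0]
  | Some (Some i), RightEnd => if l b`_i == 0 then set0 else [set Some None]
  | _, _ => set0
  end.

Lemma parity_disjoint : [disjoint [set Some None : option (option 'I_n)] & set0].
Proof. by rewrite -setI_eq0 setI0. Qed.

Definition parity_nfa : nfa unit :=
  @Nfa unit (option (option 'I_n)) parity_delta None _ _ parity_disjoint.

Lemma parity_nfa_size : state_complexity parity_nfa = n.+2.
Proof. by rewrite /state_complexity !card_option card_ord. Qed.

Let live (q : nfa_state parity_nfa) : q != Some None ->
  (q \notin nfa_halt parity_nfa) * (q \notin nfa_acc parity_nfa).
Proof. by move=> qN; rewrite !inE orbF. Qed.

(** Branching to the support of [x] extends the hypothesis linearly from the basis to [x]. The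
    predecessor discounts the right endmarker in [w]. *)
Let num_runs_coord w (x : F) :
  (forall j, (num_runs (nfa_acc parity_nfa) w (Some (Some j)))%:R
             = l (a ^+ (size w).-1 * b`_j)) ->
  (\sum_(q in [set Some (Some j) | j : 'I_n & coord b j x != 0])
     (num_runs (nfa_acc parity_nfa) w q)%:R = l (a ^+ (size w).-1 * x) :> 'F_2).
Proof.
move=> IHw; rewrite big_imset /=; last by move=> j j' _ _ [].
rewrite {2}(coord_vbasis (memvf x)) mulr_sumr linear_sum /= big_mkcond /=.
apply: eq_bigr => j _; rewrite inE IHw -scalerAr linearZ /=.
rewrite [in RHS](F2_cases (coord b j x)).
by case: ifP => _; rewrite ?mul1r ?mul0r.
Qed.

Lemma parity_nfaP m : odd (num_acc parity_nfa (nseq m tt)) = (l (a ^+ m) != 0).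
Proof.
rewrite /num_acc paths_into_num_runs odd_natF2 /tape.
have tail k j : (num_runs (nfa_acc parity_nfa)
    (rcons (map (@Letter unit) (nseq k tt)) RightEnd) (Some (Some j)))%:R
    = l (a ^+ k * b`_j).
  elim: k j => [|k IHk] j /=.
    rewrite num_runs_cons ?live //= mul1r.
    under eq_bigr do rewrite num_runs_nil.
    rewrite [in RHS](F2_cases (l _)).
    by case: (l b`_j == 0); rewrite ?big_set0 // big_set1 inE eqxx.
  rewrite num_runs_cons ?live //= natr_sum num_runs_coord.
    by rewrite size_rcons size_map size_nseq exprSr mulrA.
  by move=> i; rewrite IHk size_rcons size_map size_nseq.
rewrite num_runs_cons ?live //= natr_sum num_runs_coord.
  by rewrite size_rcons size_map size_nseq mulr1.
by move=> i; rewrite tail size_rcons size_map size_nseq.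
Qed.

End ParityMachine.

(** A true bit gets sign +1, matching a positive gap; this is why products of signs pick up a
    minus. *)
Definition bit_sign (b : bool) : rat := (-1) ^+ ~~ b.

Lemma bit_signM b c : bit_sign b * bit_sign c = - bit_sign (b (+) c).
Proof. by case: b; case: c; rewrite /bit_sign /= ?expr0 ?expr1; ring. Qed.

(** * Autocorrelation of maximal-length sequences *)

Section MaximalLengthSequence.

Variables (F : finFieldType) (l : {additive F -> 'F_2}) (x0 : F) (a : F).
Hypotheses (pchar2 : 2 \in [pchar F]) (lx0 : l x0 != 0).
Local Notation N := #|F|.-1.
Hypothesis a_prim : N.-primitive_root a.

Let bit (x : F) := l x != 0.

Let bitD x y : bit (x + y) = bit x (+) bit y.
Proof.
rewrite /bit raddfD /= [l x]F2_cases [l y]F2_cases.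
by case: (l x != 0); case: (l y != 0); rewrite ?eqxx.
Qed.

(** Translation by [x0 / c] flips every bit, so the sum equals its own negative. *)
Let sum_bit_sign c : c != 0 -> \sum_x bit_sign (bit (x * c)) = 0.
Proof.
move=> c0; set T := LHS; suff : T = - T by lra.
rewrite {1}/T (reindex_inj (addIr (x0 / c))) /= -sumrN.
apply: eq_bigr => x _; rewrite mulrDl divfK // bitD {2}/bit lx0.
by case: (bit _); rewrite /bit_sign /= ?expr0 ?expr1; ring.
Qed.

Let sum_power (f : F -> rat) : \sum_(t < N) f (a ^+ t) = \sum_(x | x != 0) f x.
Proof.
have inj_pow : injective (fun t : 'I_N => a ^+ t).
  move=> s t /eqP; rewrite (eq_prim_root_expr a_prim) !modn_small //.
  by move/eqP/val_inj.
have a0 : a != 0.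
  apply/eqP => a0; move: (prim_expr_order a_prim) (prim_order_gt0 a_prim).
  by rewrite a0 expr0n; case: (N) => // n /eqP; rewrite eq_sym oner_eq0.
rewrite -(big_imset f (h := fun t : 'I_N => a ^+ t)) /=; last by move=> ? ? _ _ /inj_pow.
apply: eq_bigl => x.
suff -> : [set a ^+ t | t : 'I_N] = [set~ 0] by rewrite !inE.
apply/eqP; rewrite eqEcard cardsC1 card_imset // card_ord leqnn andbT.
by apply/subsetP => _ /imsetP [t _ ->]; rewrite !inE expf_neq0.
Qed.

Let s m := bit (a ^+ m).

Lemma mseq_periodic m : s (m + N)%N = s m.
Proof. by rewrite /s exprD (prim_expr_order a_prim) mulr1. Qed.

Lemma unit_root_finField (x : F) : x != 0 -> x ^+ N = 1.
Proof.
move=> x0'; apply: (mulfI x0').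
by rewrite -exprS prednK ?(ltnW (finNzRing_gt1 _)) // expf_card mulr1.
Qed.

Lemma mseq_hits : exists2 m, (m < N)%N & s m.
Proof.
have x0nz : x0 != 0 by apply: contraNneq lx0 => ->; rewrite raddf0.
have [m xE] := prim_rootP a_prim (unit_root_finField x0nz).
by exists m; rewrite ?ltn_ord // /s -xE.
Qed.

(** By linearity the sum is minus the sum of the signs of [l (x * c)] over nonzero x, where
    [c = a ^+ m + a ^+ m']. If [m = m'], then c = 0 and every sign is -1; otherwise the signs over
    all of [F] cancel, and x = 0 accounts for one -1. *)
Lemma mseq_autocorrelation m m' : (m < N)%N -> (m' < N)%N ->
  \sum_(t < N) bit_sign (s (m + t)%N) * bit_sign (s (m' + t)%N)
  = (m == m')%:R * N.+1%:R - 1.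
Proof.
move=> mN m'N; under eq_bigr => t _.
  rewrite bit_signM -bitD !exprD -mulrDl mulrC.
  over.
rewrite sumrN (sum_power (fun x => bit_sign (bit (x * _)))).
have [->|mm'] := eqVneq m m'.
  under eq_bigr do rewrite (addrr_pchar2 pchar2) mulr0 /bit raddf0 eqxx.
  rewrite sumr_const mul1r /bit_sign /= expr1 mulNrn opprK -natr1 addrK.
  by congr (_%:R); rewrite -(cardsC1 (0 : F)); apply: eq_card => x; rewrite !inE.
have c0 : a ^+ m + a ^+ m' != 0.
  rewrite addr_eq0 (oppr_pchar2 pchar2) (eq_prim_root_expr a_prim).
  by rewrite !modn_small.
have := sum_bit_sign c0; rewrite (bigD1 0) //= mul0r /bit raddf0 eqxx.
by rewrite /bit_sign /= expr1 mul0r => H; lra.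
Qed.

End MaximalLengthSequence.

Lemma finField_prim_root (F : finFieldType) :
  {a : F | #|F|.-1.-primitive_root a}.
Proof.
have card1 : (1 < #|F|)%N by apply: finNzRing_gt1.
suff /hasP /sig2W [a _] : has #|F|.-1.-primitive_root (enum [set~ (0 : F)]).
  by exists a.
apply: has_prim_root; first by rewrite -subn1 subn_gt0.
- apply/allP => x; rewrite mem_enum !inE => x0.
  by rewrite unity_rootE unit_root_finField.
- exact: enum_uniq.
- by rewrite -cardE cardsC1.
Qed.

Lemma parity_nfa_mseq k (N := (2 ^ k.+1).-1) :
  {sM : (nat -> bool) * nfa unit | let: (s, M) := sM in
  [/\ state_complexity M = k.+3,
      forall m, odd (num_acc M (nseq m tt)) = s m,
      forall m, s (m + N)%N = s m,
      exists2 m, (m < N)%N & s m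
    & forall m m', (m < N)%N -> (m' < N)%N ->
      \sum_(t < N) bit_sign (s (m + t)%N) * bit_sign (s (m' + t)%N)
      = (m == m')%:R * N.+1%:R - 1]}.
Proof.
have [F pcharF cardF] := @pPrimePowerField 2 k.+1 isT isT.
have NE : N = #|F|.-1 by rewrite cardF.
pose L : fieldExtType 'F_2 := pPrimeCharType pcharF.
have dimL : \dim {:L} = k.+1.
  by rewrite pprimeChar_dimf /= cardF pfactorK.
have [a a_prim] := finField_prim_root F.
have i0 : 'I_(\dim {:L}) by rewrite dimL; exact: ord0.
(* A coordinate form is nonzero at its own basis vector, which serves as [x0]. *)
pose l : {scalar L} := coord (vbasis {:L}) i0.
exists (fun m => l ((a : L) ^+ m) != 0, parity_nfa (a : L) l).
rewrite NE.
have lx0 : l (vbasis {:L})`_i0 != 0.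
  have bE : coord (vbasis {:L}) i0 (vbasis {:L})`_i0 = 1.
    by rewrite coord_free ?eqxx // (basis_free (vbasisP _)).
  by rewrite (bE : l _ = 1) oner_eq0.
pose l' : {additive F -> 'F_2} := l.
split.
- by rewrite parity_nfa_size dimL.
- exact: parity_nfaP.
- exact: (@mseq_periodic F l' a a_prim).
- exact: (@mseq_hits F l' _ a lx0 a_prim).
- exact: (@mseq_autocorrelation F l' _ a pcharF lx0 a_prim).
Qed.

(** * A rank bound for the trace of a product *)

Section RankTrace.

Variable R : realFieldType.

Lemma sum_sqr_eq0 n (v : 'rV[R]_n) : v *m v^T = 0 -> v = 0.
Proof.
move=> /(congr1 (fun A => fun_of_matrix A 0 0)); rewrite !mxE => v0.
apply/rowP => j; rewrite mxE.
move: v0; under eq_bigr do rewrite mxE -expr2.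
move=> /eqP; rewrite psumr_eq0; last by move=> i _; apply: sqr_ge0.
by move=> /allP /(_ j); rewrite mem_index_enum sqrf_eq0 => /(_ isT) /eqP.
Qed.

(** With [B] a basis of the column space of [U], the projection is B (B^T B)^-1 B^T, whose trace is
    the rank. No orthonormal basis is formed, so no square roots arise and the rationals suffice. *)
Lemma orthogonal_projection N r (U : 'M[R]_(N, r)) :
  exists P : 'M_N, [/\ P^T = P, P *m P = P, P *m U = U & \tr P <= r%:R].
Proof.
have [k [B [V [kr UE fB]]]] : exists k (B : 'M_(N, k)) (V : 'M_(k, r)),
    [/\ (k <= r)%N, U = B *m V & row_free B^T].
  exists (\rank U), (col_base U), (row_base U); split.
  - exact: rank_leq_col.
  - by rewrite mulmx_base.
  - by rewrite /row_free mxrank_tr; exact: col_base_full.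
pose G := B^T *m B.
have G_unit : G \in unitmx.
  rewrite -row_free_unit; apply: inj_row_free => v vG.
  apply: (row_free_inj fB); rewrite mul0mx; apply: sum_sqr_eq0.
  by rewrite trmx_mul trmxK mulmxA -(mulmxA v) vG mul0mx.
have GT : G^T = G by rewrite /G trmx_mul trmxK.
exists (B *m invmx G *m B^T); split.
- by rewrite !trmx_mul trmxK trmx_inv GT mulmxA.
- by rewrite !mulmxA -(mulmxA _ B^T B) -/G -(mulmxA _ (invmx G) G) mulVmx // mulmx1.
- rewrite UE !mulmxA -(mulmxA _ B^T B) -/G.
  by rewrite -(mulmxA _ (invmx G) G) mulVmx // mulmx1.
- rewrite mxtrace_mulC mulmxA -/G mulmxV // mxtrace1.
  by rewrite ler_nat.
Qed.

(* Schur's test, with the product |p_i q_j| split by AM-GM. *)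
Lemma bilinear_bound N (H : 'M[R]_N) (p q : 'I_N -> R) B mu :
  0 < mu ->
  (forall i, \sum_j `|H i j| <= B) -> (forall j, \sum_i `|H i j| <= B) ->
  \sum_i q i ^+ 2 <= mu ^+ 2 * \sum_i p i ^+ 2 ->
  \sum_i \sum_j p i * H i j * q j <= B * mu * \sum_i p i ^+ 2.
Proof.
move=> mu0 rowB colB q_le.
have term i j : p i * H i j * q j
    <= `|H i j| * (mu / 2 * p i ^+ 2) + `|H i j| * ((2 * mu)^-1 * q j ^+ 2).
  rewrite -mulrDr; apply: le_trans (ler_norm _) _.
  have -> : p i * H i j * q j = H i j * (p i * q j) by ring.
  rewrite normrM; apply: ler_wpM2l => //.
  have : 0 <= (2 * mu)^-1 * (mu * `|p i| - `|q j|) ^+ 2.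
    by rewrite mulr_ge0 ?sqr_ge0 // invr_ge0 mulr_ge0 // ltW.
  rewrite normrM -(real_normK (num_real (p i))) -(real_normK (num_real (q j))).
  set x := `|p i|; set y := `|q j|.
  suff -> : (2 * mu)^-1 * (mu * x - y) ^+ 2
            = mu / 2 * x ^+ 2 + (2 * mu)^-1 * y ^+ 2 - x * y by rewrite subr_ge0.
  by field; rewrite gt_eqF.
(* Nonnegativity of [B] is read off a row, so the empty matrix is treated apart. *)
have [i0 _|N0] := pickP (fun _ : 'I_N => true); last first.
  by rewrite !big1 ?mulr0 // => i; have := N0 i.
have B0 : 0 <= B by apply: le_trans (rowB i0); apply: sumr_ge0.
have -> : B * mu * \sum_i p i ^+ 2 = B * (mu / 2 * \sum_i p i ^+ 2)
    + B * ((2 * mu)^-1 * (mu ^+ 2 * \sum_i p i ^+ 2)).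
  by field; rewrite gt_eqF.
apply: le_trans (_ : B * (mu / 2 * \sum_i p i ^+ 2)
    + B * ((2 * mu)^-1 * \sum_i q i ^+ 2) <= _); last first.
  by rewrite lerD2l !ler_wpM2l // invr_ge0 mulr_ge0 // ltW.
apply: le_trans (ler_sum _ (fun i _ => ler_sum _ (fun j _ => term i j))) _.
under eq_bigr do rewrite big_split /=.
rewrite big_split /=; apply: lerD.
  rewrite !mulr_sumr; apply: ler_sum => i _; rewrite -mulr_suml.
  by apply: ler_wpM2r => //; rewrite mulr_ge0 ?sqr_ge0 // divr_ge0 // ltW.
rewrite exchange_big /= !mulr_sumr; apply: ler_sum => j _; rewrite -mulr_suml.
by apply: ler_wpM2r => //; rewrite mulr_ge0 ?sqr_ge0 // invr_ge0 mulr_ge0 // ltW.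
Qed.

(** Projecting onto the column space of [H] turns the trace into a sum of forms p_k^T H S p_k over
    the columns p_k of [P]. Each is at most B mu |p_k|^2, and these squared norms add up to tr P, at
    most [r]. *)
Lemma trace_mul_le_rank N r (U : 'M[R]_(N, r)) (V : 'M_(r, N)) (S : 'M_N) B mu
    (H := U *m V) :
  0 < mu -> 0 <= B ->
  (forall i, \sum_j `|H i j| <= B) -> (forall j, \sum_i `|H i j| <= B) ->
  (forall p : 'cV_N, \sum_i (S *m p) i 0 ^+ 2 <= mu ^+ 2 * \sum_i p i 0 ^+ 2) ->
  \tr (H *m S) <= r%:R * B * mu.
Proof.
move=> mu0 B0 rowB colB S_le.
have [P [PT PP PU trP]] := orthogonal_projection U.
have PH : P *m H = H by rewrite /H mulmxA PU.
clearbody H.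
have -> : \tr (H *m S) = \tr (P^T *m (H *m (S *m P))).
  by rewrite PT !mulmxA PH [RHS]mxtrace_mulC mulmxA PH.
have term k : (P^T *m (H *m (S *m P))) k k <= B * mu * \sum_i P i k ^+ 2.
  have colE i : (S *m P) i k = (S *m col k P) i 0.
    by rewrite !mxE; apply: eq_bigr => j _; rewrite mxE.
  have := @bilinear_bound N H (fun i => P i k) (fun i => (S *m P) i k) B mu
    mu0 rowB colB.
  under [X in X <= _ -> _]eq_bigr do rewrite colE.
  have := S_le (col k P); under [X in _ <= _ * X]eq_bigr do rewrite mxE.
  move=> Sk /(_ Sk); apply: le_trans; rewrite mxE.
  apply: ler_sum => i _; rewrite [P^T k i]mxE [in X in X <= _]mxE mulr_sumr.
  by apply: ler_sum => j _; rewrite mulrA.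
apply: le_trans (ler_sum _ (fun k _ => term k)) _.
rewrite -mulr_sumr mulrC -mulrA; apply: ler_wpM2r; first by rewrite mulr_ge0 // ltW.
apply: le_trans trP; rewrite -[X in _ <= \tr X]PP; apply: ler_sum => k _; rewrite mxE.
by apply: ler_sum => i _; have -> : P k i = P i k by [rewrite -{1}PT mxE]; rewrite expr2.
Qed.

End RankTrace.

(** * Balanced windows *)

Section Windows.

Variable R : archiRealFieldType.

Lemma bernoulli_le (x : R) n : 0 <= x -> 1 + n%:R * x <= (1 + x) ^+ n.
Proof.
move=> x0; elim: n => [|n IHn]; first by rewrite mul0r addr0 expr0.
rewrite exprS; apply: le_trans (ler_wpM2l _ IHn); last by rewrite addr_ge0.
have n0 : 0 <= n%:R :> R by [].
rewrite -natr1; nra.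
Qed.

Lemma bernoulli_sub_le (x : R) n : 0 <= x <= 1 -> 1 - n%:R * x <= (1 - x) ^+ n.
Proof.
move=> /andP [x0 x1]; elim: n => [|n IHn]; first by rewrite mul0r subr0 expr0.
rewrite exprS; apply: le_trans (ler_wpM2l _ IHn); last by rewrite subr_ge0.
have n0 : 0 <= n%:R :> R by [].
rewrite -natr1; nra.
Qed.

Lemma geometric_small (q B e : R) : 0 < q < 1 -> 0 <= B -> 0 < e ->
  exists k0, forall k, (k0 <= k)%N -> B * q ^+ k <= e.
Proof.
move=> /andP [q0 q1] B0 e0; pose x := q^-1 - 1.
have x0 : 0 < x by rewrite subr_gt0 invf_gt1.
have b0 : 0 <= B / (e * x) by rewrite divr_ge0 // mulr_ge0 // ltW.
exists (Num.bound (B / (e * x))) => k kB.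
have Bk : B <= e * x * k%:R.
  rewrite mulrC -ler_pdivrMr ?mulr_gt0 //; apply: ltW.
  by apply: lt_le_trans (archi_boundP b0) _; rewrite ler_nat.
have xq : 1 + x = q^-1 by rewrite /x addrC subrK.
have := bernoulli_le k (ltW x0); rewrite xq exprVn => xk.
rewrite -ler_pdivlMr ?exprn_gt0 //; apply: le_trans Bk _.
by rewrite -mulrA; apply: ler_wpM2l; [exact: ltW|lra].
Qed.

Section BalancedWindow.

Variables (N : nat) (a : nat -> R) (K C : R).
Hypotheses (N_gt0 : (0 < N)%N) (a_ge0 : forall m, 0 <= a m).
Hypotheses (C_ge1 : 1 <= C) (a_le : forall m, a m <= K * C ^+ m).
Hypothesis a_block : forall k, 1 <= \sum_(t < N) a (t + k * N)%N.

Definition block_weight y k := \sum_(t < N) y ^+ (t + k * N) * a (t + k * N)%N.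

Local Notation S := block_weight.

Let S_ge0 y k : 0 <= y -> 0 <= S y k.
Proof. by move=> y0; apply: sumr_ge0 => t _; rewrite mulr_ge0 ?exprn_ge0. Qed.

Let S_scale_ge c y k : 1 <= c -> 0 <= y -> c ^+ (k * N) * S y k <= S (c * y) k.
Proof.
move=> c1 y0; rewrite mulr_sumr; apply: ler_sum => t _.
rewrite exprMn mulrA; apply: ler_wpM2r => //; apply: ler_wpM2r; first exact: exprn_ge0.
by apply: ler_weXn2l => //; rewrite leq_addl.
Qed.

Let S_scale_le c y k : 1 <= c -> 0 <= y -> S (c * y) k <= c ^+ (N * k.+1) * S y k.
Proof.
move=> c1 y0; rewrite mulr_sumr; apply: ler_sum => t _.
rewrite exprMn mulrA; apply: ler_wpM2r => //; apply: ler_wpM2r; first exact: exprn_ge0.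
by apply: ler_weXn2l => //; rewrite mulnS mulnC leq_add2r ltnW.
Qed.

(** By Bernoulli q^(2N) is at least 2/3. Hence raising the ratio by c^2 multiplies the k-th block
    weight by at most (3/2)^(k+1), which a decay like (2/3)^k can absorb. *)
Let q : R := 1 - (6 * N)%:R^-1.
Let c := q^-1.

Let q_gt0 : 0 < q.
Proof. by rewrite subr_gt0 invf_lt1 ?ltr0n ?ltr1n ?muln_gt0 //; lia. Qed.

Let q_lt1 : q < 1.
Proof. by rewrite ltrBlDr ltrDl invr_gt0 ltr0n muln_gt0. Qed.

Let c_ge1 : 1 <= c.
Proof. by rewrite invf_ge1 // ltW. Qed.

Let c_pow : (c ^+ 2) ^+ N <= 3 / 2.
Proof.
have x01 : 0 <= ((6 * N)%:R^-1 : R) <= 1.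
  by rewrite invr_ge0 ler0n invf_le1 ?ltr0n ?ler1n ?muln_gt0.
have := bernoulli_sub_le (2 * N) x01.
have -> : (2 * N)%:R * (6 * N)%:R^-1 = 3^-1 :> R.
  by rewrite !natrM; field; rewrite pnatr_eq0 -lt0n.
rewrite -/q -exprM /c exprVn => qN.
rewrite -[3 / 2]invrK lef_pV2 ?posrE ?exprn_gt0 ?invr_gt0 //.
  by apply: le_trans qN; lra.
by rewrite divr_gt0.
Qed.

Let bounded y := exists B, forall k, S y k <= B.

Let bounded_ge0 y : 0 <= y -> bounded y -> exists2 B, 0 <= B & forall k, S y k <= B.
Proof.
by move=> y0 [B SB]; exists B => //; apply: le_trans (SB 0%N); apply: S_ge0.
Qed.

(* Stated by double negation, which keeps the proof constructive. Without a
   balanced window, a ratio [y] with bounded block weights could be increased by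
   the factor [c] forever, but at large ratios the block weights are unbounded. *)
Lemma balanced_window :
  (forall y i J, 0 < y -> (i < J)%N ->
     3 * S y i <= \sum_(i <= k < J) S y k ->
     3 * S y J <= \sum_(i <= k < J) S y k -> False) -> False.
Proof.
move=> unbalanced.
have bounded_step y : 0 < y -> bounded y -> bounded (c * y).
  (* Going down to [w = q * y] makes the block weights decay geometrically. *)
  move=> y0 /(bounded_ge0 (ltW y0)) [B B0 SB]; pose w := q * y.
  have w0 : 0 < w by rewrite mulr_gt0.
  have cw : c * w = y by rewrite mulrA mulVf ?mul1r // gt_eqF.
  have Sw k : S w k <= B * q ^+ k.
    rewrite -ler_pdivrMr ?exprn_gt0 //; apply: le_trans (SB k).
    rewrite -exprVn -/c mulrC -cw; apply: le_trans (S_scale_ge _ _ (ltW w0)) => //.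
    apply: ler_wpM2r; first exact: S_ge0 (ltW w0).
    by apply: ler_weXn2l => //; rewrite leq_pmulr.
  (* Otherwise extending the window until its right boundary block is small enough would make it
     balanced. *)
  have tail i J : \sum_(i <= k < J) S w k <= 3 * S w i.
    rewrite leNgt; apply/negP => Wi.
    have Si0 := S_ge0 i (ltW w0).
    have W0 : 0 < (\sum_(i <= k < J) S w k) / 3 by lra.
    have [k0 small] := geometric_small (introT andP (conj q_gt0 q_lt1)) B0 W0.
    have iJ : (i < J)%N.
      by rewrite ltnNge; apply/negP => Ji; move: Wi; rewrite big_geq //; lra.
    pose J' := maxn J k0.
    have WJ : \sum_(i <= k < J) S w k <= \sum_(i <= k < J') S w k.
      rewrite [leRHS](@big_cat_nat _ _ _ J) ?leq_maxl //=; last exact: ltnW.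
      by rewrite lerDl; apply: sumr_ge0 => k _; apply: S_ge0 (ltW w0).
    apply: (unbalanced w i J') => //.
    - by apply: leq_trans iJ _; apply: leq_maxl.
    - by lra.
    - have := small J' (leq_maxr _ _); have := Sw J'; lra.
  (* Dropping the first block removes at least a third of the remaining sum. *)
  have decay i J : (i <= J)%N ->
      \sum_(i <= k < J) S w k <= (2 / 3) ^+ i * \sum_(0 <= k < J) S w k.
    elim: i => [|i IHi] iJ; first by rewrite expr0 mul1r.
    have := IHi (ltnW iJ); have := tail i J; rewrite big_ltn // exprS.
    by set X := (2 / 3) ^+ i * _; rewrite -mulrA -/X; lra.
  have Swi i : S w i <= (2 / 3) ^+ i * (3 * S w 0%N).
    apply: le_trans (_ : (2 / 3) ^+ i * \sum_(0 <= k < i.+1) S w k <= _).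
      by apply: le_trans (decay i i.+1 _) => //; rewrite big_nat1.
    by apply: ler_wpM2l => //; apply: exprn_ge0; rewrite divr_ge0.
  have d0 : 0 <= 3 / 2 :> R by rewrite divr_ge0.
  exists (3 / 2 * (3 * S w 0%N)) => k.
  (* The ratio to be reached lies two factors [c] above [w]. *)
  have -> : c * y = c ^+ 2 * w by rewrite -cw expr2 mulrA.
  have c21 : 1 <= c ^+ 2 by apply: exprn_ege1.
  apply: le_trans (S_scale_le _ c21 (ltW w0)) _.
  rewrite exprM; apply: le_trans (_ : (3 / 2) ^+ k.+1 * S w k <= _).
    apply: ler_wpM2r; first exact: S_ge0 (ltW w0).
    by apply: lerXn2r; rewrite ?nnegrE ?exprn_ge0 // (le_trans ler01 c_ge1).
  apply: le_trans (ler_wpM2l _ (Swi k)) _; first by apply: exprn_ge0.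
  have e1 : (3 / 2 : R) ^+ k * (2 / 3) ^+ k = 1.
    by rewrite -exprMn [X in X ^+ _](_ : _ = 1) ?expr1n //; field.
  set X := 3 * S w 0%N.
  have -> : (3 / 2) ^+ k.+1 * ((2 / 3) ^+ k * X)
      = (3 / 2 : R) ^+ k * (2 / 3) ^+ k * (3 / 2 * X).
    by rewrite exprS; ring.
  by rewrite e1 mul1r.
have C0 : 0 < C by apply: lt_le_trans C_ge1.
have c0 : 0 < c by rewrite invr_gt0.
(* At ratio 1/C the growth bound caps every term by [K]; boundedness then climbs by factors [c]. *)
have bounded_all j : bounded (c ^+ j * C^-1).
  elim: j => [|j IHj].
    rewrite expr0 mul1r; exists (\sum_(t < N) K) => k; apply: ler_sum => t _.
    rewrite exprVn mulrC ler_pdivrMr ?exprn_gt0 //.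
  by rewrite exprS -mulrA; apply: bounded_step => //; rewrite mulr_gt0 ?exprn_gt0 ?invr_gt0.
have q01 : 0 < q < 1 by rewrite q_gt0.
(* At a ratio [y] of at least 1 every block weighs at least 1, so at [c * y] the k-th weight is at
   least c^k, contradicting boundedness. *)
have [j0 /(_ j0 (leqnn _)) y1] := geometric_small q01 (ltW C0) ltr01.
pose y := c ^+ j0 / C.
have {}y1 : 1 <= y.
  by rewrite ler_pdivlMr // mul1r /c exprVn -[leRHS]mul1r ler_pdivlMr ?exprn_gt0.
have y0 : 0 < y by apply: lt_le_trans y1.
have := bounded_all j0.+1; rewrite exprS -mulrA -/y.
move=> /(bounded_ge0 (ltW (mulr_gt0 c0 y0))) [B B0 SB].
have half0 : 0 < 1 / 2 :> R by rewrite divr_gt0.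
have [k /(_ k (leqnn _))] := geometric_small q01 B0 half0.
apply/negP; rewrite -ltNge; apply: lt_le_trans (_ : 1 <= _); first by lra.
rewrite -ler_pdivrMr ?exprn_gt0 // mul1r -exprVn -/c; apply: le_trans (SB k).
apply: le_trans (S_scale_ge _ c_ge1 (ltW y0)).
have Sy : 1 <= S y k.
  apply: le_trans (a_block k) _; apply: ler_sum => t _.
  by apply: ler_peMl => //; apply: exprn_ege1.
apply: le_trans (_ : c ^+ (k * N) <= _).
  by apply: ler_weXn2l => //; rewrite leq_pmulr.
by apply: ler_peMr => //; apply: exprn_ge0; apply: ltW.
Qed.

End BalancedWindow.

End Windows.

(** * Dimension of a sign representation *)

Lemma ler_sum_subrange (R : numDomainType) (f : nat -> R) i j k l :
  (forall x, 0 <= f x) -> (k <= i)%N -> (i <= j)%N -> (j <= l)%N ->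
  \sum_(i <= x < j) f x <= \sum_(k <= x < l) f x.
Proof.
move=> f0 ki ij jl.
rewrite [leRHS](@big_cat_nat _ _ _ i) ?(leq_trans ij) //=.
rewrite (@big_cat_nat _ _ _ j i l) //=.
by rewrite addrCA lerDl addr_ge0 //; apply: sumr_ge0.
Qed.

Lemma sum_blocks (R : nmodType) (f : nat -> R) N i J : (i <= J)%N ->
  \sum_(i <= k < J) \sum_(t < N) f (t + k * N)%N = \sum_(i * N <= x < J * N) f x.
Proof.
have shift c : \sum_(t < N) f (t + c)%N = \sum_(c <= x < N + c) f x.
  by rewrite -{2}[c]add0n big_addn addnK big_mkord.
move=> /subnK <-; elim: (J - i)%N => [|n IHn]; first by rewrite !big_geq.
rewrite addSn big_nat_recr ?leq_addl //= IHn shift -mulSn.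
rewrite [RHS](@big_cat_nat _ _ _ ((n + i) * N)) //= ?leq_mul2r ?leq_addl ?orbT //.
by rewrite leqnSn orbT.
Qed.

(** Supplies the exponential bound from which the balanced-window argument gets its starting ratio;
    [C] dominates every absolute row sum of [A]. *)
Lemma matrix_power_growth (R : realDomainType) d (u : 'rV[R]_d) (A : 'M_d)
    (v : 'cV_d) :
  exists K C, 1 <= C /\ forall m, `|(u *m A ^+ m *m v) 0 0| <= K * C ^+ m.
Proof.
pose C := 1 + \sum_i \sum_j `|A i j|; pose V := \sum_i `|v i 0|.
have C1 : 1 <= C by rewrite lerDl; apply: sumr_ge0 => i _; apply: sumr_ge0.
have C0 : 0 <= C by apply: le_trans C1.
have V0 : 0 <= V by apply: sumr_ge0.
have col_le m i : `|(A ^+ m *m v) i 0| <= V * C ^+ m.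
  elim: m i => [|m IHm] i.
    rewrite expr0 mul1mx mulr1 /V (bigD1 i) //= lerDl; exact: sumr_ge0.
  rewrite exprS -mulmxE -mulmxA mxE; apply: le_trans (ler_norm_sum _ _ _) _.
  apply: le_trans (_ : \sum_j `|A i j| * (V * C ^+ m) <= _).
    by apply: ler_sum => j _; rewrite normrM; apply: ler_wpM2l.
  rewrite -mulr_suml exprS mulrCA; apply: ler_wpM2l => //.
  apply: ler_wpM2r; first exact: exprn_ge0.
  rewrite /C [X in 1 + X](bigD1 i) //= addrCA lerDl addr_ge0 //.
  by apply: sumr_ge0 => j _; apply: sumr_ge0.
exists ((\sum_i `|u 0 i|) * V), C; split=> // m.
rewrite -mulmxA mxE; apply: le_trans (ler_norm_sum _ _ _) _.
rewrite -mulrA mulr_suml; apply: ler_sum => j _.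
by rewrite normrM; apply: ler_wpM2l.
Qed.

Lemma mulmx_exprD (R : pzRingType) d (u : 'rV[R]_d) (A : 'M_d) (v : 'cV_d) m k :
  (u *m A ^+ (m + k) *m v) 0 0
  = \sum_r (u *m A ^+ m) 0 r * (A ^+ k *m v) r 0.
Proof.
have -> : A ^+ (m + k) = A ^+ m *m A ^+ k by rewrite exprD.
by rewrite mulmxA -mulmxA mxE.
Qed.

Section SignedSequence.

Variables (s : nat -> bool) (N : nat) (mu : rat).
Hypotheses (s_per : forall m, s (m + N)%N = s m).
Hypothesis (s_hits : exists2 m, (m < N)%N & s m).
Hypothesis s_corr : forall m m', (m < N)%N -> (m' < N)%N ->
  \sum_(t < N) bit_sign (s (m + t)%N) * bit_sign (s (m' + t)%N)
  = (m == m')%:R * N.+1%:R - 1.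
Hypotheses (mu_gt0 : 0 < mu) (mu_sqr : mu ^+ 2 = N.+1%:R).

Let sg m := bit_sign (s m).

Let s_perM m k : s (m + k * N)%N = s m.
Proof. by elim: k => [|k IHk]; rewrite ?addn0 // mulSn (addnC N) addnA s_per. Qed.

Let sg_sqr m : sg m * sg m = 1.
Proof. by rewrite /sg /bit_sign -expr2 sqrr_sign. Qed.

Let sg_hankel : 'M[rat]_N := \matrix_(i, j) sg (i + j)%N.

(** Autocorrelation gives T^2 = (N+1) I - J for T = [sg_hankel], so |T p|^2 is mu^2 |p|^2 minus the
    square of the sum of [p]. *)
Lemma sign_hankel_norm (p : 'cV[rat]_N) :
  \sum_i (sg_hankel *m p) i 0 ^+ 2 <= mu ^+ 2 * \sum_i p i 0 ^+ 2.
Proof.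
have -> : \sum_i (sg_hankel *m p) i 0 ^+ 2
    = \sum_m \sum_m' p m 0 * p m' 0 * \sum_(t < N) sg (m + t)%N * sg (m' + t)%N.
  have sqE (i : 'I_N) : (sg_hankel *m p) i 0 ^+ 2
      = \sum_m \sum_m' (sg_hankel i m * p m 0) * (sg_hankel i m' * p m' 0).
    rewrite mxE expr2 mulr_suml; apply: eq_bigr => m _.
    by rewrite mulr_sumr.
  under eq_bigr do rewrite sqE.
  rewrite exchange_big; apply: eq_bigr => m _ /=.
  rewrite exchange_big; apply: eq_bigr => m' _ /=.
  rewrite mulr_sumr; apply: eq_bigr => t _.
  by rewrite !mxE ![(t + _)%N]addnC; ring.
have -> : \sum_m \sum_m' p m 0 * p m' 0 * (\sum_(t < N) sg (m + t)%N * sg (m' + t)%N)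
    = mu ^+ 2 * (\sum_i p i 0 ^+ 2) - (\sum_i p i 0) ^+ 2.
  rewrite [X in _ - X]expr2 [X in _ - X]mulr_suml mulr_sumr -sumrB; apply: eq_bigr => m _.
  under eq_bigr do rewrite s_corr // mulrBr mulr1.
  rewrite sumrB mulr_sumr; congr (_ - _).
  rewrite (bigD1 m) //= eqxx mul1r mu_sqr big1; first by rewrite addr0; ring.
  by move=> m' /negPf m'm; rewrite val_eqE eq_sym m'm mul0r mulr0.
by rewrite gerDl oppr_le0 sqr_ge0.
Qed.

Section Bound.

Variables (d : nat) (u : 'rV[rat]_d) (A : 'M[rat]_d) (v : 'cV[rat]_d).
Let g m := (u *m A ^+ m *m v) 0 0.
Hypotheses (g_pos : forall m, s m -> 1 <= g m)
           (g_neg : forall m, ~~ s m -> g m <= 0).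

(** This is the absolute value of [g m], since the signs of [g] agree with [sg]. *)
Let a m := sg m * g m.

Let a_ge0 m : 0 <= a m.
Proof.
rewrite /a /sg /bit_sign; case: (boolP (s m)) => sm /=.
  by rewrite expr0 mul1r (le_trans ler01) ?g_pos.
by rewrite expr1 mulN1r oppr_ge0 g_neg.
Qed.

Let gE m : g m = sg m * a m.
Proof. by rewrite /a mulrA sg_sqr mul1r. Qed.

Let a_hit k : exists t : 'I_N, 1 <= a (t + k * N)%N.
Proof.
have [t tN st] := s_hits; exists (Ordinal tN) => /=.
by rewrite /a /sg /bit_sign s_perM st expr0 mul1r g_pos // s_perM.
Qed.

Let N_gt0 : (0 < N)%N.
Proof. by have [t tN _] := s_hits; apply: leq_trans tN. Qed.

Section Window.

Variables (y : rat) (i J : nat).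
Hypotheses (y_gt0 : 0 < y) (iJ : (i < J)%N).
Let W := \sum_(i <= k < J) block_weight N a y k.
Hypotheses (lo : 3 * block_weight N a y i <= W)
           (hi : 3 * block_weight N a y J <= W).

Let e x := y ^+ x * a x.

Let e_ge0 x : 0 <= e x.
Proof. by rewrite mulr_ge0 // exprn_ge0 // ltW. Qed.

Let b m := \sum_(i <= j < J) e (m + j * N)%N.

Let W_gt0 : 0 < W.
Proof.
apply: lt_le_trans (_ : block_weight N a y i <= _).
  have [t at1] := a_hit i; rewrite /block_weight (bigD1 t) //=.
  apply: ltr_wpDr; first by apply: sumr_ge0 => t' _; apply: e_ge0.
  by rewrite mulr_gt0 ?exprn_gt0 // (lt_le_trans ltr01).
rewrite /W big_ltn // lerDl; apply: sumr_ge0 => k _; apply: sumr_ge0 => t _.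
exact: e_ge0.
Qed.

Let WE : W = \sum_(i * N <= x < J * N) e x.
Proof. by rewrite -sum_blocks // ltnW. Qed.

Let blockE k : block_weight N a y k = \sum_(k * N <= x < k.+1 * N) e x.
Proof. by rewrite -sum_blocks // big_nat1. Qed.

(** Unfolding a row gives the window shifted by [m]. For [m < N] the shift loses at most the block
    [i] and gains at most the block [J], each at most a third of [W]. *)
Let row_sumE m : \sum_(t < N) b (m + t)%N = \sum_(i * N + m <= x < J * N + m) e x.
Proof.
rewrite [RHS](@big_addn _ _ _ (i * N) _ m) addnK.
rewrite -(sum_blocks (fun x => e (x + m)%N) N (ltnW iJ)).
rewrite exchange_big /=; apply: eq_bigr => k _; apply: eq_bigr => t _.
by congr e; lia.
Qed.

Let row_sum_le m : (m < N)%N -> \sum_(t < N) b (m + t)%N <= 4 / 3 * W.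
Proof.
move=> mN; rewrite row_sumE; apply: le_trans (_ : W + block_weight N a y J <= _).
  rewrite WE blockE.
  rewrite -(@big_cat_nat _ _ _ (J * N) (i * N) (J.+1 * N) xpredT e) /=.
  - by apply: ler_sum_subrange => //; nia.
  - by rewrite leq_mul2r ltnW ?orbT.
  - by rewrite leq_mul2r leqnSn orbT.
by move: hi; move: (block_weight N a y J) (W) => w w'; lra.
Qed.

Let row_sum_ge m : (m < N)%N -> 2 / 3 * W <= \sum_(t < N) b (m + t)%N.
Proof.
move=> mN; rewrite row_sumE.
suff : W <= block_weight N a y i + \sum_(i * N + m <= x < J * N + m) e x.
  move: lo; move: (block_weight N a y i) (W) (\sum_(_ <= x < _) _) => w w' w''.
  by lra.
apply: le_trans (_ : \sum_(i * N <= x < i * N + m) e x +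
    \sum_(i * N + m <= x < J * N + m) e x <= _).
  rewrite -(@big_cat_nat _ _ _ (i * N + m) (i * N) (J * N + m) xpredT e) /=.
  - by rewrite WE; apply: ler_sum_subrange => //; nia.
  - exact: leq_addr.
  - by rewrite leq_add2r leq_mul2r ltnW ?orbT.
by rewrite lerD2r blockE; apply: ler_sum_subrange => //; nia.
Qed.

(** Splitting each power of [A] at [m] factors the folded Hankel matrix through dimension [d]. *)
Let U : 'M[rat]_(N, d) := \matrix_(m, r) (y ^+ m * (u *m A ^+ m) 0 r).
Let V : 'M[rat]_(d, N) := \matrix_(r, t)
  \sum_(i <= j < J) y ^+ (t + j * N) * (A ^+ (t + j * N) *m v) r 0.

(** Folding adds positions congruent modulo [N]; by periodicity they share one sign, so nothing
    cancels. *)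
Let hankelE m t : (U *m V) m t = sg (m + t)%N * b (m + t)%N.
Proof.
rewrite mxE; under eq_bigr do rewrite [U _ _]mxE [V _ _]mxE mulr_sumr.
rewrite exchange_big mulr_sumr; apply: eq_bigr => j _ /=.
have -> : sg (m + t)%N * e (m + t + j * N)%N
          = y ^+ (m + t + j * N) * g (m + t + j * N)%N.
  by rewrite gE /e /sg s_perM mulrCA.
rewrite -addnA /g mulmx_exprD (exprD y m) mulr_sumr.
by apply: eq_bigr => r _; rewrite mulrACA.
Qed.

Lemma window_dim_bound : N%:R <= 2 * d%:R * mu.
Proof.
have b_ge0 m : 0 <= b m by apply: sumr_ge0.
have normH m t : `|(U *m V) m t| = b (m + t)%N.
  by rewrite hankelE normrM /sg /bit_sign normrX normrN1 expr1n mul1r ger0_norm.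
have rowH m : \sum_t `|(U *m V) m t| <= 4 / 3 * W.
  by under eq_bigr do rewrite normH; apply: row_sum_le.
have colH t : \sum_m `|(U *m V) m t| <= 4 / 3 * W.
  by under eq_bigr do rewrite normH addnC; apply: row_sum_le.
have [B0 W23] : 0 <= 4 / 3 * W /\ 0 < 2 / 3 * W.
  by move: W_gt0; move: (W) => w; lra.
have := trace_mul_le_rank mu_gt0 B0 rowH colH sign_hankel_norm.
have : N%:R * (2 / 3 * W) <= \tr (U *m V *m sg_hankel).
  rewrite mulr_natl -[X in _ *+ X]card_ord -sumr_const.
  apply: ler_sum => m _; rewrite mxE.
  (* Each entry of [U *m V] meets its own sign in [sg_hankel], so the diagonal of the product
     consists of row sums of [b]. *)
  under [leRHS]eq_bigr => t _.
    rewrite hankelE mxE mulrAC (addnC t m) sg_sqr mul1r.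
    over.
  exact: row_sum_ge.
move=> /le_trans /[apply].
have -> : d%:R * (4 / 3 * W) * mu = 2 * d%:R * mu * (2 / 3 * W) by field.
by rewrite (ler_pM2r W23).
Qed.

End Window.

Lemma signed_sequence_dim_bound : N%:R <= 2 * d%:R * mu.
Proof.
(* Arguing by refutation yields the goal [False] required by [balanced_window]. *)
rewrite leNgt; apply/negP => small.
have [K [C [C1 gC]]] := matrix_power_growth u A v.
have aC m : a m <= K * C ^+ m.
  apply: le_trans (ler_norm _) _.
  by rewrite /a normrM /sg /bit_sign normrX normrN1 expr1n mul1r; exact: gC.
have a1 k : 1 <= \sum_(t < N) a (t + k * N)%N.
  have [t at1] := a_hit k; rewrite (bigD1 t) //= (le_trans at1) // lerDl.
  exact: sumr_ge0.
apply: (balanced_window N_gt0 a_ge0 C1 aC a1) => y i J y0 iJ lo hi.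
by have := window_dim_bound y0 iJ lo hi; rewrite leNgt small.
Qed.

End Bound.

End SignedSequence.

(** * The separation *)

Lemma poly_lt_exp2 (p : {poly nat}) : exists n, (p.[n] < 2 ^ n)%N.
Proof.
pose C := (\sum_(i < size p) nth 0 p i)%N; pose D := size p.
(* At n = 2^(2i) the bound C n^D is at most 2^(C + 2iD), and C + 2iD < (i+1)^2 <= 2^(2i) = n. *)
pose i := (C + 2 * D)%N; exists (2 ^ (2 * i))%N.
have p_le n : (0 < n)%N -> (p.[n] <= C * n ^ D)%N.
  move=> n0; rewrite horner_coef /C big_distrl /=; apply: leq_sum => k _.
  by rewrite leq_mul2l leq_pexp2l ?orbT // ltnW.
apply: leq_ltn_trans (p_le _ _) _; first by rewrite expn_gt0.
apply: leq_ltn_trans (_ : 2 ^ C * (2 ^ (2 * i)) ^ D < _)%N.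
  by rewrite leq_mul2r ltnW ?orbT // ltn_expl.
rewrite -expnM -expnD ltn_exp2l //.
have : (i.+1 * i.+1 <= 2 ^ (2 * i))%N.
  by rewrite mul2n -addnn expnD leq_mul // ltn_expl.
by apply: leq_trans; rewrite /i; nia.
Qed.

Lemma seq_unitE (x : seq unit) : x = nseq (size x) tt.
Proof. by elim: x => [|[] x {1}->]. Qed.

Theorem theorem4p11 :
  ~ (forall L : promise_family, one_parity L -> one_P L).
Proof.
move=> parity_sub_P.
have [s [M sM]] : {s : nat -> nat -> bool & {M : nat -> nfa unit |
  forall n, let N := (2 ^ (2 * n).+2).-1 in
  [/\ state_complexity (M n) = (2 * n).+4,
      forall m, odd (num_acc (M n) (nseq m tt)) = s n m,
      forall m, s n (m + N)%N = s n m,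
      exists2 m, (m < N)%N & s n m
    & forall m m', (m < N)%N -> (m' < N)%N ->
      \sum_(t < N) bit_sign (s n (m + t)%N) * bit_sign (s n (m' + t)%N)
      = (m == m')%:R * N.+1%:R - 1]}}.
  (* The degree 2n+2 is even, so that N+1 = 4^(n+1) has the rational square root 2^(n+1), used below
     as [mu]. *)
  pose f n := parity_nfa_mseq (2 * n).+1.
  exists (fun n => (sval (f n)).1), (fun n => (sval (f n)).2) => n.
  by case: (f n) => [[]].
(* Membership depends only on the length, and every word satisfies the promise, so the gap is
   constrained at every length. *)
have disj n (x : seq unit) : ~ (s n (size x) /\ ~~ s n (size x)).
  by case=> ->.
pose L := PromiseFamily disj.
have /parity_sub_P : one_parity L.
  exists (PartialFamily (fun _ _ => True) (fun n (x : seq unit) => num_acc (M n) x)).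
  split=> // [|n x sx|n x sx]; last 2 first.
  - by rewrite /= [x]seq_unitE; have [_ -> _ _ _] := sM n.
  - by rewrite /= [x]seq_unitE; have [_ -> _ _ _] := sM n.
  exists M; split=> //; exists (2%N%:P * 'X + 4%N%:P) => n.
  have [-> _ _ _ _] := sM n; rewrite !hornerE.
  by rewrite -[X in (_ <= X)%N]/(2 * n + 4)%N; lia.
move=> [f [[M' [[p M'p] fE]] fD fpos fneg]].
have [n pn] := poly_lt_exp2 p.
have [_ _ s_per s_hits s_corr] := sM n.
have [u [A [v gE]]] := gap_matrix_power (M' n).
have gint m : (u *m A ^+ m *m v) 0 0 = (pf_val f n (nseq m tt))%:~R.
  rewrite -gE fE; last by apply: fD => /=; rewrite size_nseq; case: (s n m); [left|right].
  by rewrite rmorphB.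
pose mu : rat := (2 ^ n.+1)%:R.
have mu0 : 0 < mu by rewrite ltr0n expn_gt0.
have NE : (2 ^ (2 * n).+2).-1.+1 = (2 ^ n.+1 * 2 ^ n.+1)%N.
  by rewrite prednK ?expn_gt0 // -expnD; congr (2 ^ _)%N; lia.
have mu2 : mu ^+ 2 = (2 ^ (2 * n).+2).-1.+1%:R by rewrite NE natrM expr2.
(* Gaps are integers, so positivity improves to at least 1. *)
have g_pos m : s n m -> 1 <= (u *m A ^+ m *m v) 0 0.
  move=> sm; rewrite gint ler1z.
  by have := fpos n (nseq m tt); rewrite /= size_nseq => /(_ sm).
have g_neg m : ~~ s n m -> (u *m A ^+ m *m v) 0 0 <= 0.
  move=> sm; rewrite gint lerz0.
  by have := fneg n (nseq m tt); rewrite /= size_nseq => /(_ sm).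
have := signed_sequence_dim_bound s_per s_hits s_corr mu0 mu2 g_pos g_neg.
rewrite /mu -!natrM ler_nat => N_le.
move: N_le NE (leq_ltn_trans (M'p n) pn); rewrite /state_complexity !(expnS 2 n).
move: (2 ^ n)%N #|_| (_.-1) => X D N.
(* Here N + 1 = 4X^2, N <= 4DX and D < X, so 4X^2 - 1 <= 4X^2 - 4X, which is impossible for X >=
   1. *)
by nia.
Qed.
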